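(* Let $S\in\mathbb{R}^{n\times n}$, $n=2m$, be nonsingular and skew-symmetric with eigenvalues $\pm\mathrm{i}\sigma_j$, $j=1,\ldots,m$, where $\sigma_1>\sigma_2\ge\cdots\ge\sigma_m>0$, and let $u_j,v_j\in\mathbb{R}^n$ be such that $\{u_1,\ldots,u_m,v_1,\ldots,v_m\}$ is an orthonormal basis of $\mathbb{R}^n$ and $\frac{\sqrt2}{2}(u_j\pm\mathrm{i}v_j)$ are eigenvectors of $S$ for $\pm\mathrm{i}\sigma_j$ (equivalently $Sv_j=\sigma_ju_j$, $Su_j=-\sigma_jv_j$). Let $q_0\in\mathbb{R}^n$ be a unit vector written as $$q_0=\sum_{i=1}^m\big[\alpha_i(u_i+\mathrm{i}v_i)+\bar\alpha_i(u_i-\mathrm{i}v_i)\big]=2\sum_{i=1}^m(\alpha_{i,1}u_i-\alpha_{i,2}v_i),$$ with $\alpha_i=\alpha_{i,1}+\mathrm{i}\alpha_{i,2}$, and assume $\alpha_1\neq0$. Define $q_{2k+1}=Sq_{2k}/\|Sq_{2k}\|$, $q_{2k+2}=-Sq_{2k+1}/\|Sq_{2k+1}\|$ and $\rho_k=q_{2k+1}^TSq_{2k+2}$ for $k=0,1,\ldots$. Set $$x_o=\frac{-1}{|\alpha_1|}(\alpha_{1,1}v_1+\alpha_{1,2}u_1),\qquad x_e=\frac{1}{|\alpha_1|}(\alpha_{1,1}u_1-\alpha_{1,2}v_1).$$ Then $x_o,x_e$ are orthonormal, $\frac{\sqrt2}{2}(x_o\pm\mathrm{i}x_e)$ are unit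 eigenvectors of $S$ for the eigenvalues $\pm\mathrm{i}\sigma_1$, and for all $k\ge1$: $$|\tan\angle(q_{2k},x_e)|\le\Big(\frac{\sigma_2}{\sigma_1}\Big)^{2k}|\tan\angle(q_0,x_e)|,$$ $$|\tan\angle(q_{2k-1},x_o)|\le\Big(\frac{\sigma_2}{\sigma_1}\Big)^{2(k-1)}|\tan\angle(Sq_0,x_o)|,$$ $$|\tan\angle(q_{2k-1},x_o)|\le\Big(\frac{\sigma_2}{\sigma_1}\Big)^{2k-1}|\tan\angle(q_0,x_e)|.$$ Moreover, $$|\rho_k-\sigma_1|\le\frac12\tan^2\angle(q_{2k+1},x_o)\,\sigma_1+O\big(\tan^4\angle(q_{2k+1},x_o)\big)=O\Big(\Big(\frac{\sigma_2}{\sigma_1}\Big)^{4k}\Big).$$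
   Context: $\|\cdot\|$ is the Euclidean norm; $\angle(x,y)$ denotes the acute angle between real vectors $x,y$, i.e. $\cos\angle(x,y)=|x^Ty|/(\|x\|\|y\|)$. The iteration defining $q_k$ and $\rho_k$ is the skew-symmetric power (SSP) method, which alternately applies $S$ and $S^T=-S$ with normalization. *)

(* Defs.v *)
From HB Require Import structures.
From mathcomp Require Import all_boot all_order all_algebra.
From mathcomp Require Import all_classical all_reals all_analysis.
From mathcomp Require Import complex.
Set Implicit Arguments. Unset Strict Implicit. Unset Printing Implicit Defensive.
Import Order.TTheory GRing.Theory Num.Theory.
Local Open Scope ring_scope.
Local Open Scope complex_scope.

Section Defs.
Variable R : realType.

Definition dotv n (x y : 'cV[R]_n) : R := (x^T *m y) 0 0.
Definition vnorm n (x : 'cV[R]_n) : R := Num.sqrt (dotv x x).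

Definition vangle n (x y : 'cV[R]_n) : R :=
  acos (`|dotv x y| / (vnorm x * vnorm y)).

Fixpoint ssp_q n (S : 'M[R]_n) (q0 : 'cV[R]_n) (j : nat) : 'cV[R]_n :=
  match j with
  | 0%N => q0
  | j'.+1 => let p := ssp_q S q0 j' in
             ((if odd j' then -1 else 1) / vnorm (S *m p)) *: (S *m p)
  end.

Definition ssp_rho n (S : 'M[R]_n) (q0 : 'cV[R]_n) (k : nat) : R :=
  dotv (ssp_q S q0 k.*2.+1) (S *m ssp_q S q0 k.*2.+2).

Definition cvC n (x : 'cV[R]_n) : 'cV[R[i]]_n := map_mx (fun a => a%:C) x.
Definition mxC n (A : 'M[R]_n) : 'M[R[i]]_n := map_mx (fun a => a%:C) A.
Definition cnorm2 n (z : 'cV[R[i]]_n) : R[i] := \sum_i (z i 0)^* * z i 0.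
End Defs.

(* Main.v *)
(* In the plane spanned by [xo] and [xe] the matrix [S] acts as [sigma 1] times
   a rotation by a right angle, while the span [W] of the remaining [u i, v i]
   is invariant and [S] multiplies norms there by at most [sigma 2].  Every
   iterate is thus [c *: x + w] with [c > 0], [w] in [W], and [x] equal to [xe]
   at even and to [xo] at odd steps; its tangent with [x] is [vnorm w / c], and
   one step multiplies this quotient by at most [sigma 2 / sigma 1].
   Skew-symmetry turns [rho k] into [vnorm (S *m q (2k+1))]. *)
Require Import Defs.
From HB Require Import structures.
From mathcomp Require Import all_boot all_order all_algebra.
From mathcomp Require Import all_classical all_reals all_analysis.
From mathcomp Require Import complex zify ring lra.
Import Order.TTheory GRing.Theory Num.Theory.
Local Open Scope ring_scope.
Local Open Scope complex_scope.

Lemma le_of_sqr (R : realDomainType) (x y : R) : 0 <= y -> x ^+ 2 <= y ^+ 2 -> x <= y.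
Proof.
by move=> y0 xy; rewrite leNgt; apply/negP => yx; nra.
Qed.

(** * Inner product, norm and acute angle of real vectors *)

Section Dotv.
Variables (R : realType) (n : nat).
Implicit Types (x y z w : 'cV[R]_n) (c : R).

Lemma dotvE x y : dotv x y = \sum_i x i 0 * y i 0.
Proof. by rewrite /dotv mxE; apply: eq_bigr => i _; rewrite mxE. Qed.

Lemma dotvC x y : dotv x y = dotv y x.
Proof. by rewrite !dotvE; apply: eq_bigr => i _; rewrite mulrC. Qed.

Lemma dotvDr x y z : dotv x (y + z) = dotv x y + dotv x z.
Proof. by rewrite /dotv mulmxDr mxE. Qed.

Lemma dotvZr c x y : dotv x (c *: y) = c * dotv x y.
Proof. by rewrite /dotv -scalemxAr mxE. Qed.

Lemma dotvDl x y z : dotv (y + z) x = dotv y x + dotv z x.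
Proof. by rewrite dotvC dotvDr !(dotvC x). Qed.

Lemma dotvZl c x y : dotv (c *: x) y = c * dotv x y.
Proof. by rewrite dotvC dotvZr dotvC. Qed.

Lemma dotv_sumr x (F : nat -> 'cV[R]_n) l h :
  dotv x (\sum_(l <= i < h) F i) = \sum_(l <= i < h) dotv x (F i).
Proof.
by rewrite /dotv mulmx_sumr summxE.
Qed.

Lemma dotv_ge0 x : 0 <= dotv x x.
Proof. by rewrite dotvE; apply: sumr_ge0 => i _; rewrite -expr2 sqr_ge0. Qed.

Lemma vnorm_ge0 x : 0 <= vnorm x. Proof. exact: sqrtr_ge0. Qed.

Lemma vnorm_sqr x : vnorm x ^+ 2 = dotv x x.
Proof. by rewrite sqr_sqrtr ?dotv_ge0. Qed.

Lemma vnormZ c x : vnorm (c *: x) = `|c| * vnorm x.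
Proof.
by rewrite /vnorm dotvZl dotvZr mulrA -expr2 sqrtrM ?sqr_ge0// sqrtr_sqr.
Qed.

Lemma vangleZl c x y : 0 < c -> vangle (c *: x) y = vangle x y.
Proof.
move=> c0; rewrite /vangle dotvZl vnormZ normrM (gtr0_norm c0) -(mulrA c (vnorm x)).
by rewrite -mulf_div divff ?gt_eqF// mul1r.
Qed.

Lemma dotv_skew (S : 'M[R]_n) x y : S^T = - S ->
  dotv x (S *m y) = - dotv (S *m x) y.
Proof.
move=> skS; rewrite /dotv trmx_mul skS mulmxN mulNmx [X in - X]mxE.
by rewrite opprK mulmxA.
Qed.

Lemma dotv_pythagoras c x w : dotv x x = 1 -> dotv x w = 0 ->
  dotv (c *: x + w) (c *: x + w) = c ^+ 2 + dotv w w.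
Proof.
by move=> x1 xw; rewrite !(dotvDl, dotvDr, dotvZl, dotvZr) (dotvC w x) x1 xw; ring.
Qed.

(** With [N] the norm of [c *: x + w], the cosine is [c / N], so by Pythagoras the sine is
    [vnorm w / N] and [N] cancels in the quotient. Positivity of [c] removes the absolute value in
    [vangle]. *)
Lemma tan_vangle c x w : dotv x x = 1 -> dotv x w = 0 -> 0 < c ->
  tan (vangle (c *: x + w) x) = vnorm w / c.
Proof.
move=> x1 xw c0; rewrite /vangle.
have -> : dotv (c *: x + w) x = c.
  by rewrite dotvDl dotvZl x1 (dotvC w) xw mulr1 addr0.
have -> : vnorm x = 1 by rewrite /vnorm x1 sqrtr1.
rewrite mulr1 gtr0_norm//.
set N := vnorm _.
have N2 : N ^+ 2 = c ^+ 2 + vnorm w ^+ 2 by rewrite !vnorm_sqr dotv_pythagoras.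
have N0 : 0 < N.
  rewrite lt0r vnorm_ge0 andbT; apply/eqP => N0; move: N2; rewrite N0.
  by have := sqr_ge0 (vnorm w); nra.
have cN : c <= N by apply: le_of_sqr; rewrite ?(ltW N0)// N2 lerDl sqr_ge0.
(* [acos] inverts [cos] only on this interval; both [sin_acos] and [acosK] ask for it. *)
have cN1 : -1 <= c / N <= 1.
  by rewrite (le_trans _ (divr_ge0 (ltW c0) (ltW N0))) ?lerN10// ler_pdivrMr// mul1r.
rewrite /tan sin_acos// acosK ?in_itv//=.
have -> : 1 - (c / N) ^+ 2 = (vnorm w / N) ^+ 2.
  rewrite !expr_div_n (_ : vnorm w ^+ 2 = N ^+ 2 - c ^+ 2); last by rewrite N2; ring.
  by field; rewrite gt_eqF.
rewrite sqrtr_sqr ger0_norm ?divr_ge0 ?vnorm_ge0 ?(ltW N0)//.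
by field; rewrite !gt_eqF.
Qed.

End Dotv.

(** * The iteration on a plane plus an orthogonal invariant set *)

Section PlaneAndRest.
Variables (R : realType) (n : nat) (S : 'M[R]_n) (W : 'cV[R]_n -> Prop).
Variables (xo xe : 'cV[R]_n) (s1 s2 : R).
Hypotheses (s2_ge0 : 0 <= s2) (s21 : s2 <= s1) (s1_gt0 : 0 < s1).
Hypotheses (xo1 : dotv xo xo = 1) (xe1 : dotv xe xe = 1).
Hypotheses (Sxe : S *m xe = s1 *: xo) (Sxo : S *m xo = - s1 *: xe).
Hypotheses (WZ : forall c w, W w -> W (c *: w)) (WS : forall w, W w -> W (S *m w)).
Hypotheses (Wxo : forall w, W w -> dotv xo w = 0) (Wxe : forall w, W w -> dotv xe w = 0).
Hypothesis WSle : forall w, W w -> vnorm (S *m w) <= s2 * vnorm w.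
Variable q0 : 'cV[R]_n.

Definition ssp_axis (j : nat) := if odd j then xo else xe.

Lemma ssp_axis1 j : dotv (ssp_axis j) (ssp_axis j) = 1.
Proof. by rewrite /ssp_axis; case: ifP. Qed.

Lemma ssp_axisW j w : W w -> dotv (ssp_axis j) w = 0.
Proof. by rewrite /ssp_axis; case: ifP => _; [apply: Wxo | apply: Wxe]. Qed.

(** The sign at odd [j] is the one [ssp_q] puts into its step. The two cancel, so the coefficient
    along the axis stays positive throughout. *)
Lemma mulmx_ssp_axis j :
  S *m ssp_axis j = ((if odd j then -1 else 1) * s1) *: ssp_axis j.+1.
Proof. by rewrite /ssp_axis /=; case: (odd j); rewrite ?Sxo ?Sxe ?mulN1r ?mul1r. Qed.

(** The axis part alone contributes [(s1 * c) ^+ 2] to the squared norm. Hence no normalization in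
    the iteration divides by zero. *)
Lemma vnorm_mulmx_gt0 j c w : 0 < c -> W w -> 0 < vnorm (S *m (c *: ssp_axis j + w)).
Proof.
move=> c0 Ww; rewrite sqrtr_gt0 mulmxDr -scalemxAr mulmx_ssp_axis scalerA.
rewrite dotv_pythagoras ?ssp_axis1 ?ssp_axisW//; last exact: WS.
rewrite ltr_pwDl ?dotv_ge0// exprn_even_gt0//=.
rewrite !mulf_neq0 ?(gt_eqF c0) ?(gt_eqF s1_gt0)//.
by case: odd; rewrite ?oppr_eq0 oner_eq0.
Qed.

Definition ssp_split j (x : 'cV[R]_n) c w :=
  [/\ x = c *: ssp_axis j + w, 0 < c & W w].

Lemma ssp_split_step j x c w : ssp_split j x c w ->
  let t := (if odd j then -1 else 1) / vnorm (S *m x) in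
  ssp_split j.+1 (t *: (S *m x)) (s1 * c / vnorm (S *m x)) (t *: (S *m w)).
Proof.
move=> [-> c0 Ww] /=; have N0 := vnorm_mulmx_gt0 j c w c0 Ww.
split; [|by rewrite divr_gt0 ?mulr_gt0|by apply/WZ/WS].
rewrite {2}mulmxDr scalerDr -scalemxAr mulmx_ssp_axis !scalerA.
congr (_ *: _ + _); case: (odd j); by field; rewrite gt_eqF.
Qed.

Lemma tan_ssp_split j x c w : ssp_split j x c w ->
  tan (vangle x (ssp_axis j)) = vnorm w / c.
Proof. by move=> [-> c0 Ww]; rewrite tan_vangle ?ssp_axis1 ?ssp_axisW. Qed.

Lemma ssp_q_split j : (exists c w, ssp_split 0 q0 c w) ->
  exists c w, ssp_split j (ssp_q S q0 j) c w.
Proof.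
move=> q0W; elim: j => [//|j [c [w /ssp_split_step sp]]].
by eexists; eexists; exact: sp.
Qed.

Definition ssp_tan j := tan (vangle (ssp_q S q0 j) (ssp_axis j)).

Hypothesis q0W : exists c w, ssp_split 0 q0 c w.

Lemma ssp_tan_ge0 j : 0 <= ssp_tan j.
Proof.
have [c [w sp]] := ssp_q_split j q0W; rewrite /ssp_tan (tan_ssp_split _ _ _ _ sp).
by case: sp => _ c0 _; rewrite divr_ge0 ?vnorm_ge0 ?ltW.
Qed.

(** The normalizing factor cancels in the quotient [vnorm w / c]; its denominator grows by exactly
    [s1], its numerator by at most [s2]. *)
Lemma ssp_tanS j : ssp_tan j.+1 <= s2 / s1 * ssp_tan j.
Proof.
have [c [w sp]] := ssp_q_split j q0W.
rewrite /ssp_tan (tan_ssp_split _ _ _ _ sp) /=.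
rewrite (tan_ssp_split _ _ _ _ (ssp_split_step _ _ _ _ sp)).
case: sp => -> c0 Ww; have N0 := vnorm_mulmx_gt0 j c w c0 Ww.
set N := vnorm _ in N0 *.
rewrite vnormZ normrM normfV (gtr0_norm N0).
have -> : `|if odd j then -1 else 1| = 1 :> R by case: odd; rewrite ?normrN normr1.
have -> : 1 / N * vnorm (S *m w) / (s1 * c / N) = vnorm (S *m w) / (s1 * c).
  by field; rewrite !gt_eqF.
have -> : s2 / s1 * (vnorm w / c) = s2 * vnorm w / (s1 * c) by field; rewrite !gt_eqF.
by rewrite ler_wpM2r ?WSle// invr_ge0 mulr_ge0 ?ltW.
Qed.

Lemma ssp_tan_le i j : ssp_tan (i + j) <= (s2 / s1) ^+ i * ssp_tan j.
Proof.
elim: i => [|i IH]; first by rewrite mul1r.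
rewrite addSn (le_trans (ssp_tanS _))// exprS -[leRHS]mulrA ler_wpM2l//.
by rewrite divr_ge0 ?(ltW s1_gt0).
Qed.

(** The first iterate is a positive multiple of [S *m q0], and scaling keeps the angle. *)
Lemma tan_vangle_mulmx_q0 : tan (vangle (S *m q0) xo) = ssp_tan 1.
Proof.
have [c [w [q0E c0 Ww]]] := q0W.
have N0 : 0 < vnorm (S *m q0) by rewrite q0E; exact: vnorm_mulmx_gt0.
by rewrite /ssp_tan /= vangleZl// divr_gt0.
Qed.

Hypotheses (Sskew : S^T = - S) (q0_unit : vnorm q0 = 1).

Lemma ssp_q_unit j : vnorm (ssp_q S q0 j) = 1.
Proof.
case: j => [//|j] /=; have [c [w [-> c0 Ww]]] := ssp_q_split j q0W.
have N0 := vnorm_mulmx_gt0 j c w c0 Ww.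
rewrite vnormZ normrM normfV (gtr0_norm N0).
by case: odd; rewrite ?normrN normr1 mul1r mulVf ?gt_eqF.
Qed.

(** The step leaving an odd index carries a minus sign, which cancels the one from moving [S] across
    the inner product; what remains is the squared norm of [S *m q] over its norm. *)
Lemma ssp_rho_vnorm k : ssp_rho S q0 k = vnorm (S *m ssp_q S q0 k.*2.+1).
Proof.
set q := ssp_q S q0 k.*2.+1.
have -> : ssp_rho S q0 k = dotv q (S *m (-1 / vnorm (S *m q) *: (S *m q))).
  by rewrite /ssp_rho /q /= odd_double.
have N0 : 0 < vnorm (S *m q).
  rewrite /q; have [c [w [-> c0 Ww]]] := ssp_q_split k.*2.+1 q0W.
  exact: vnorm_mulmx_gt0.
rewrite dotv_skew// dotvZr -vnorm_sqr.
by field; rewrite gt_eqF.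
Qed.

(* With [c] the cosine of the angle, [s1 * c <= rho k <= s1], and
   [1 - c <= (1 - c ^+ 2) / (2 * c ^+ 2)] because [c <= 1]. *)
Lemma ssp_rho_bound k :
  `|ssp_rho S q0 k - s1| <= 1 / 2 * ssp_tan k.*2.+1 ^+ 2 * s1.
Proof.
have [c [w sp]] := ssp_q_split k.*2.+1 q0W.
rewrite ssp_rho_vnorm /ssp_tan (tan_ssp_split _ _ _ _ sp).
have := ssp_q_unit k.*2.+1; case: sp => -> c0 Ww q1.
have cw1 : c ^+ 2 + vnorm w ^+ 2 = 1.
  rewrite vnorm_sqr -(dotv_pythagoras _ _ _ _ _ (ssp_axis1 k.*2.+1)) ?ssp_axisW//.
  by rewrite -vnorm_sqr q1 expr1n.
set N := vnorm (S *m _).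
have N2 : N ^+ 2 = (s1 * c) ^+ 2 + vnorm (S *m w) ^+ 2.
  rewrite !vnorm_sqr mulmxDr -scalemxAr mulmx_ssp_axis scalerA.
  rewrite dotv_pythagoras ?ssp_axis1 ?ssp_axisW//; last exact: WS.
  by congr (_ + _); case: odd; ring.
have N0 : 0 <= N by exact: vnorm_ge0.
have w0 := vnorm_ge0 _ _ w.
have Sw0 := vnorm_ge0 _ _ (S *m w).
have c1 : c <= 1 by apply: le_of_sqr => //; rewrite expr1n -cw1 lerDl sqr_ge0.
have cN : s1 * c <= N by apply: le_of_sqr => //; rewrite N2 lerDl sqr_ge0.
(* Since [s2 <= s1], neither part of the unit iterate is stretched by more than [s1]; this yields
   the upper bound [N <= s1]. *)
have Sws1 : vnorm (S *m w) <= s1 * vnorm w.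
  by rewrite (le_trans (WSle _ Ww))// ler_wpM2r.
have Ns1 : N <= s1.
  apply: le_of_sqr; first exact: ltW.
  have -> : s1 ^+ 2 = (s1 * c) ^+ 2 + (s1 * vnorm w) ^+ 2.
    by rewrite !exprMn -mulrDr cw1 mulr1.
  by rewrite N2 lerD2l ler_pXn2r ?nnegrE ?mulr_ge0 ?(ltW s1_gt0).
rewrite distrC ger0_norm ?subr_ge0//.
apply: (@le_trans _ _ ((1 - c) * s1)); first by lra.
rewrite ler_wpM2r ?(ltW s1_gt0)// expr_div_n.
rewrite (_ : vnorm w ^+ 2 = 1 - c ^+ 2); last by rewrite -cw1; ring.
rewrite mulrA ler_pdivlMr ?exprn_gt0// -subr_ge0.
have -> : 1 / 2 * (1 - c ^+ 2) - (1 - c) * c ^+ 2 = (1 - c) ^+ 2 * (1 / 2 + c) by field.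
by rewrite mulr_ge0 ?sqr_ge0//; lra.
Qed.

End PlaneAndRest.

(** * Complex eigenvectors in terms of real and imaginary parts *)

Section Complexification.
Variables (R : realType) (n : nat).
Implicit Types (x y : 'cV[R]_n) (s k : R) (S : 'M[R]_n).

Lemma complexM k s (x y : R) :
  (k +i* s) * (x +i* y) = (k * x - s * y) +i* (k * y + s * x).
Proof. by []. Qed.

Lemma complexD k s (x y : R) : (k +i* s) + (x +i* y) = (k + x) +i* (s + y).
Proof. by []. Qed.

Lemma conjCE (x y : R) : Num.conj (x +i* y) = x +i* - y.
Proof. by []. Qed.

Lemma cvCD x y : cvC (x + y) = cvC x + cvC y.
Proof. by apply/matrixP => i j; rewrite !mxE rmorphD. Qed.

Lemma cvC0 : cvC (0 : 'cV[R]_n) = 0.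
Proof. by apply/matrixP => i j; rewrite !mxE. Qed.

Lemma cvCN x : cvC (- x) = - cvC x.
Proof. by apply/matrixP => i j; rewrite !mxE rmorphN. Qed.

Lemma cvC_inj : injective (@cvC R n).
Proof.
move=> x y /matrixP xy; apply/matrixP => i j.
by have := xy i j; rewrite !mxE => -[].
Qed.

Lemma cvC_mulmx S x : mxC S *m cvC x = cvC (S *m x).
Proof. by rewrite /mxC /cvC -(map_mxM (real_complex R)). Qed.

Lemma cvC_addiE x y i j : (cvC x + 'i *: cvC y) i j = x i j +i* y i j.
Proof. by rewrite !mxE -complexiE complexM complexD; congr (_ +i* _); ring. Qed.

Lemma cvC_addi_inj (x y x' y' : 'cV[R]_n) :
  cvC x + 'i *: cvC y = cvC x' + 'i *: cvC y' -> x = x' /\ y = y'.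
Proof.
move=> E; have {}E i j : x i j +i* y i j = x' i j +i* y' i j.
  by rewrite -!cvC_addiE E.
by split; apply/matrixP => i j; case: (E i j).
Qed.

Lemma scaleC_addi k s x y :
  (k +i* s) *: (cvC x + 'i *: cvC y) =
  cvC (k *: x - s *: y) + 'i *: cvC (k *: y + s *: x).
Proof.
apply/matrixP => i j.
by rewrite cvC_addiE [LHS]mxE cvC_addiE complexM !mxE.
Qed.

(** Separates the eigenvalue equation for ['i * s%:C] into [S *m x = - s *: y] and
    [S *m y = s *: x]; the passage in either direction rests on it. *)
Lemma scale_imaginary_addi s x y :
  ('i * s%:C) *: (cvC x + 'i *: cvC y) = cvC (- s *: y) + 'i *: cvC (s *: x).
Proof.
have -> : 'i * s%:C = 0 +i* s :> R[i].
  by rewrite -complexiE complexM !mul0r mulr0 subr0 mul1r add0r.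
by rewrite scaleC_addi !scale0r !add0r scaleNr.
Qed.

Lemma cvC_eigen k s S x y : S *m x = - s *: y -> S *m y = s *: x ->
  mxC S *m (k%:C *: (cvC x + 'i *: cvC y)) =
  ('i * s%:C) *: (k%:C *: (cvC x + 'i *: cvC y)).
Proof.
move=> Sx Sy; rewrite -scalemxAr mulmxDr -scalemxAr !cvC_mulmx Sx Sy.
by rewrite [RHS]scalerA mulrC -[RHS]scalerA scale_imaginary_addi.
Qed.

(** The conjugate case is [cvC_eigen] with both [s] and [y] negated. *)
Lemma cvC_eigenN k s S x y : S *m x = - s *: y -> S *m y = s *: x ->
  mxC S *m (k%:C *: (cvC x - 'i *: cvC y)) =
  (- 'i * s%:C) *: (k%:C *: (cvC x - 'i *: cvC y)).
Proof.
move=> Sx Sy; have := @cvC_eigen k (- s) S x (- y).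
rewrite cvCN scalerN mulmxN Sx Sy opprK scalerN scaleNr rmorphN mulrN mulNr.
by apply; rewrite ?scaleNr.
Qed.

(** After cancelling [k], compare real and imaginary parts. This recovers the real action of [S] on
    each pair [u j], [v j]. *)
Lemma cvC_eigen_inv k s S x y : k != 0 ->
  mxC S *m (k%:C *: (cvC x + 'i *: cvC y)) =
  ('i * s%:C) *: (k%:C *: (cvC x + 'i *: cvC y)) ->
  S *m x = - s *: y /\ S *m y = s *: x.
Proof.
move=> k0; rewrite -scalemxAr [RHS]scalerA mulrC -[RHS]scalerA => /scalerI E.
apply: cvC_addi_inj; rewrite -scale_imaginary_addi -E; last first.
  by apply: contra_neq k0 => -[].
by rewrite -!cvC_mulmx scalemxAr -mulmxDr.
Qed.

Lemma cnorm2_addi k x y :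
  cnorm2 (k%:C *: (cvC x + 'i *: cvC y)) = (k ^+ 2 * (dotv x x + dotv y y))%:C.
Proof.
rewrite scaleC_addi !scale0r subr0 addr0 /cnorm2.
under eq_bigr do rewrite cvC_addiE.
rewrite !dotvE -big_split mulr_sumr rmorph_sum; apply: eq_bigr => i _.
rewrite conjCE complexM; congr (_ +i* _); rewrite !mxE /=; ring.
Qed.

(** The two summands are conjugate, so their sum is twice a real part. It turns the complex
    expansion of [q0] into a real one. *)
Lemma scaleC_conjC (c : R[i]) x y :
  c *: (cvC x + 'i *: cvC y) + c^* *: (cvC x - 'i *: cvC y) =
  cvC ((2 * complex.Re c) *: x + (- 2 * complex.Im c) *: y).
Proof.
rewrite -scalerN -cvCN; case: c => a b; rewrite conjCE !scaleC_addi.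
apply/matrixP => i j; rewrite [LHS]mxE !cvC_addiE complexD [RHS]mxE /=.
by congr (_ +i* _); rewrite !mxE; ring.
Qed.

End Complexification.

(** * Combinations of the orthonormal pairs *)

Section OrthonormalPairs.
Variables (R : realType) (n m : nat) (S : 'M[R]_n).
Variables (sigma : nat -> R) (u v : nat -> 'cV[R]_n).
Hypothesis uv_orth : forall i j, (1 <= i <= m)%N -> (1 <= j <= m)%N ->
  [/\ dotv (u i) (u j) = (i == j)%:R, dotv (v i) (v j) = (i == j)%:R
    & dotv (u i) (v j) = 0].
Hypothesis S_uv : forall j, (1 <= j <= m)%N ->
  S *m u j = - sigma j *: v j /\ S *m v j = sigma j *: u j.

(** The lower index serves two uses: [l = 1] expands [q0], and [l = 2] describes the complement of
    the first pair. *)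
Definition uv_comb l (a b : nat -> R) : 'cV[R]_n :=
  \sum_(l <= i < m.+1) (a i *: u i + b i *: v i).

(** Only the term [i = j] survives. The case [j < l] later gives orthogonality to the first pair. *)
Lemma dotv_u_comb l j a b : (1 <= l)%N -> (1 <= j <= m)%N ->
  dotv (u j) (uv_comb l a b) = if (l <= j)%N then a j else 0.
Proof.
move=> l1 jm; rewrite dotv_sumr.
rewrite (eq_big_nat _ _ (F2 := fun i => if i == j then a i else 0)) => [|i /andP[li im]].
  rewrite -big_mkcond big_nat1_eq ltnS; case/andP: jm => _ ->.
  by rewrite andbT.
have im' : (1 <= i <= m)%N by rewrite (leq_trans l1 li).
rewrite dotvDr !dotvZr; have [-> _ ->] := uv_orth _ _ jm im'.
by rewrite eq_sym mulr0 addr0; case: eqP; rewrite ?mulr1 ?mulr0.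
Qed.

Lemma dotv_v_comb l j a b : (1 <= l)%N -> (1 <= j <= m)%N ->
  dotv (v j) (uv_comb l a b) = if (l <= j)%N then b j else 0.
Proof.
move=> l1 jm; rewrite dotv_sumr.
rewrite (eq_big_nat _ _ (F2 := fun i => if i == j then b i else 0)) => [|i /andP[li im]].
  rewrite -big_mkcond big_nat1_eq ltnS; case/andP: jm => _ ->.
  by rewrite andbT.
have im' : (1 <= i <= m)%N by rewrite (leq_trans l1 li).
rewrite dotvDr !dotvZr; have [_ -> _] := uv_orth _ _ jm im'.
rewrite dotvC; have [_ _ ->] := uv_orth _ _ im' jm.
by rewrite eq_sym mulr0 add0r; case: eqP; rewrite ?mulr1 ?mulr0.
Qed.

(** Parseval's identity: pairing with a basis vector returns its coefficient. *)
Lemma dotv_comb l a b : (1 <= l)%N ->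
  dotv (uv_comb l a b) (uv_comb l a b) = \sum_(l <= i < m.+1) (a i ^+ 2 + b i ^+ 2).
Proof.
move=> l1; rewrite {2}/uv_comb dotv_sumr; apply: eq_big_nat => i /andP[li im].
have im' : (1 <= i <= m)%N by rewrite (leq_trans l1 li).
rewrite dotvDr !dotvZr ![dotv (uv_comb _ _ _) _]dotvC.
by rewrite dotv_u_comb// dotv_v_comb// li !expr2.
Qed.

Lemma scale_comb l c a b :
  c *: uv_comb l a b = uv_comb l (fun i => c * a i) (fun i => c * b i).
Proof.
by rewrite scaler_sumr; apply: eq_bigr => i _; rewrite scalerDr !scalerA.
Qed.

Lemma mulmx_comb l a b : (1 <= l)%N ->
  S *m uv_comb l a b =
  uv_comb l (fun i => sigma i * b i) (fun i => - (sigma i * a i)).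
Proof.
move=> l1; rewrite mulmx_sumr; apply: eq_big_nat => i /andP[li im].
have [Su Sv] : S *m u i = - sigma i *: v i /\ S *m v i = sigma i *: u i.
  by apply: S_uv; rewrite (leq_trans l1 li).
rewrite mulmxDr -!scalemxAr Su Sv !scalerA addrC.
by congr (_ *: _ + _ *: _); ring.
Qed.

(** Within each pair [S] swaps the two coefficients up to sign and scales them by [sigma i], so the
    Parseval sums compare term by term. *)
Lemma vnorm_mulmx_comb l a b s : (1 <= l)%N -> 0 <= s ->
  (forall i, (l <= i <= m)%N -> 0 <= sigma i <= s) ->
  vnorm (S *m uv_comb l a b) <= s * vnorm (uv_comb l a b).
Proof.
move=> l1 s0 sigma_s; apply: le_of_sqr; first by rewrite mulr_ge0 ?vnorm_ge0.
rewrite exprMn !vnorm_sqr mulmx_comb// !dotv_comb// mulr_sumr.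
apply: ler_sum_nat => i /sigma_s/andP[si0 sis].
rewrite sqrrN !exprMn -mulrDr addrC ler_wpM2r ?addr_ge0 ?sqr_ge0//.
by rewrite ler_pXn2r ?nnegrE.
Qed.

End OrthonormalPairs.

(** * Convergence of the skew-symmetric power method *)

Theorem theorem3p3 (R : realType) (m n : nat) (Hm : (2 <= m)%N) (Hn : n = (2 * m)%N)
  (S : 'M[R]_n) (Hskew : S^T = - S) (Hnonsing : S \in unitmx)
  (sigma : nat -> R)
  (Hs12 : sigma 2%N < sigma 1%N)
  (Hsdec : forall j, (2 <= j < m)%N -> sigma j.+1 <= sigma j)
  (Hspos : forall j, (1 <= j <= m)%N -> 0 < sigma j)
  (u v : nat -> 'cV[R]_n)
  (Horth : forall i j, (1 <= i <= m)%N -> (1 <= j <= m)%N ->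
     [/\ dotv (u i) (u j) = (i == j)%:R, dotv (v i) (v j) = (i == j)%:R
       & dotv (u i) (v j) = 0])
  (Heigp : forall j, (1 <= j <= m)%N ->
     let w := (Num.sqrt 2 / 2)%:C *: (cvC (u j) + 'i *: cvC (v j)) in
     mxC S *m w = ('i * (sigma j)%:C) *: w)
  (Heigm : forall j, (1 <= j <= m)%N ->
     let w := (Num.sqrt 2 / 2)%:C *: (cvC (u j) - 'i *: cvC (v j)) in
     mxC S *m w = (- 'i * (sigma j)%:C) *: w)
  (q0 : 'cV[R]_n) (Hq0 : vnorm q0 = 1)
  (alpha : nat -> R[i])
  (Hq0a : cvC q0 = \sum_(1 <= i < m.+1)
            (alpha i *: (cvC (u i) + 'i *: cvC (v i))
             + (alpha i)^* *: (cvC (u i) - 'i *: cvC (v i))))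
  (Ha1 : alpha 1%N != 0) :
  let a11 := complex.Re (alpha 1%N) in
  let a12 := complex.Im (alpha 1%N) in
  let absa := Num.sqrt (a11 ^+ 2 + a12 ^+ 2) in
  let xo := (- 1 / absa) *: (a11 *: v 1%N + a12 *: u 1%N) in
  let xe := (1 / absa) *: (a11 *: u 1%N - a12 *: v 1%N) in
  let q := ssp_q S q0 in
  let rho := ssp_rho S q0 in
  let r := sigma 2%N / sigma 1%N in
  let wp := (Num.sqrt 2 / 2)%:C *: (cvC xo + 'i *: cvC xe) in
  let wm := (Num.sqrt 2 / 2)%:C *: (cvC xo - 'i *: cvC xe) in
  [/\ dotv xo xo = 1 /\ dotv xe xe = 1 /\ dotv xo xe = 0,
      (mxC S *m wp = ('i * (sigma 1%N)%:C) *: wp /\ cnorm2 wp = 1)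
      /\ (mxC S *m wm = (- 'i * (sigma 1%N)%:C) *: wm /\ cnorm2 wm = 1),
      forall k, (1 <= k)%N ->
        [/\ `|tan (vangle (q k.*2) xe)| <= r ^+ k.*2 * `|tan (vangle q0 xe)|,
            `|tan (vangle (q k.*2.-1) xo)|
               <= r ^+ (k.-1).*2 * `|tan (vangle (S *m q0) xo)|
          & `|tan (vangle (q k.*2.-1) xo)| <= r ^+ k.*2.-1 * `|tan (vangle q0 xe)|],
      exists C : R, exists K : nat, forall k, (K <= k)%N ->
        `|rho k - sigma 1%N|
          <= 1 / 2 * tan (vangle (q k.*2.+1) xo) ^+ 2 * sigma 1%N
             + C * tan (vangle (q k.*2.+1) xo) ^+ 4
    & exists C : R, exists K : nat, forall k, (K <= k)%N ->
        `|rho k - sigma 1%N| <= C * r ^+ (4 * k)].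
Proof.
move=> a11 a12 absa xo xe q rho r wp wm.
have m1 : (1 <= 1 <= m)%N by rewrite (leq_trans _ Hm).
have m2 : (1 <= 2 <= m)%N by rewrite Hm.
have s1_gt0 : 0 < sigma 1%N by exact: Hspos.
have s2_gt0 : 0 < sigma 2%N by exact: Hspos.
have sle i : (2 <= i <= m)%N -> 0 <= sigma i <= sigma 2%N.
  elim: i => [//|i IH] /andP[i2 im]; rewrite ltW ?Hspos//=.
  (* The effective base case is index 2, where the bound is an equality. *)
  have [i1|i2'] := leqP i 1; first by have -> : i = 1%N by lia.
  have /IH/andP[_] : (2 <= i <= m)%N by rewrite i2' ltnW.
  by apply: le_trans; apply: Hsdec; rewrite i2' im.
have k0 : Num.sqrt 2 / 2 != 0 :> R by rewrite mulf_neq0 ?invr_eq0 ?gt_eqF// sqrtr_gt0.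
have S_uv j : (1 <= j <= m)%N ->
    S *m u j = - sigma j *: v j /\ S *m v j = sigma j *: u j.
  by move=> /Heigp; exact: cvC_eigen_inv.
have [Su1 Sv1] := S_uv _ m1.
have [uu1 vv1 uv1] : [/\ dotv (u 1%N) (u 1%N) = 1,
    dotv (v 1%N) (v 1%N) = 1 & dotv (u 1%N) (v 1%N) = 0].
  exact: (Horth _ _ m1 m1).
have a2_gt0 : 0 < a11 ^+ 2 + a12 ^+ 2.
  rewrite lt0r addr_ge0 ?sqr_ge0// andbT paddr_eq0 ?sqr_ge0// !sqrf_eq0.
  apply: contra Ha1 => /andP[/eqP a0 /eqP b0].
  by apply/eqP/eqP; rewrite eq_complex /= -/a11 -/a12 a0 b0 eqxx.
have absa_gt0 : 0 < absa by rewrite sqrtr_gt0.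
have absa2 : absa ^+ 2 = a11 ^+ 2 + a12 ^+ 2 by rewrite sqr_sqrtr ?ltW.
(* Putting this quotient for 1 makes the two norm computations below rational identities in [absa],
   [a11] and [a12]. *)
have absa2V : (a11 ^+ 2 + a12 ^+ 2) / absa ^+ 2 = 1 by rewrite absa2 divff ?gt_eqF.
have xo1 : dotv xo xo = 1.
  rewrite !(dotvDl, dotvDr, dotvZl, dotvZr)
    (dotvC _ _ (v 1%N) (u 1%N)) uu1 vv1 uv1 -[RHS]absa2V.
  by field; rewrite gt_eqF.
have xe1 : dotv xe xe = 1.
  rewrite /xe -scaleN1r !(dotvDl, dotvDr, dotvZl, dotvZr)
    (dotvC _ _ (v 1%N) (u 1%N)) uu1 vv1 uv1 -[RHS]absa2V.
  by field; rewrite gt_eqF.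
have xoxe : dotv xo xe = 0.
  rewrite /xe -scaleN1r !(dotvDl, dotvDr, dotvZl, dotvZr)
    (dotvC _ _ (v 1%N) (u 1%N)) uu1 vv1 uv1.
  by field; rewrite gt_eqF.
have Sxe : S *m xe = sigma 1%N *: xo.
  rewrite -scalemxAr mulmxBr -!scalemxAr Su1 Sv1.
  by apply/matrixP => i j; rewrite !mxE; ring.
have Sxo : S *m xo = - sigma 1%N *: xe.
  rewrite -scalemxAr mulmxDr -!scalemxAr Su1 Sv1.
  by apply/matrixP => i j; rewrite !mxE; ring.
pose W w := exists a b, w = uv_comb R n m u v 2 a b.
have WZ c w : W w -> W (c *: w).
  by move=> [a [b ->]]; rewrite scale_comb; do 2 eexists.
have WS w : W w -> W (S *m w).
  move=> [a [b ->]]; rewrite (mulmx_comb _ _ _ _ sigma)//.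
  by do 2 eexists.
have Wu w : W w -> dotv (u 1%N) w = 0.
  by move=> [a [b ->]]; rewrite dotv_u_comb.
have Wv w : W w -> dotv (v 1%N) w = 0.
  by move=> [a [b ->]]; rewrite dotv_v_comb.
have Wxo w : W w -> dotv xo w = 0.
  by move=> Ww; rewrite dotvZl dotvDl !dotvZl Wu// Wv//; ring.
have Wxe w : W w -> dotv xe w = 0.
  by move=> Ww; rewrite dotvZl -scaleNr dotvDl !dotvZl Wu// Wv//; ring.
have WSle w : W w -> vnorm (S *m w) <= sigma 2%N * vnorm w.
  by move=> [a [b ->]]; apply: (vnorm_mulmx_comb _ _ _ _ sigma); rewrite ?ltW.
have q0W : exists c w, ssp_split R n W xo xe 0 q0 c w.
  pose a i := 2 * complex.Re (alpha i).
  pose b i := - 2 * complex.Im (alpha i).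
  (* The first pair contributes [2 * (a11 u_1 - a12 v_1)], which is [2 * absa] times [xe];
     [alpha 1 != 0] makes this coefficient positive. *)
  exists (2 * absa), (uv_comb R n m u v 2 a b).
  split; [|by rewrite mulr_gt0|by exists a, b].
  have -> : q0 = uv_comb R n m u v 1 a b.
    apply: cvC_inj; rewrite Hq0a (big_morph _ (@cvCD R n) (@cvC0 R n)).
    by apply: eq_bigr => i _; rewrite scaleC_conjC.
  rewrite /uv_comb big_ltn; last by rewrite ltnS; case/andP: m1.
  congr (_ + _); rewrite /ssp_axis /= /a /b -/a11 -/a12.
  apply/matrixP => i j; rewrite !mxE; field; exact: lt0r_neq0.
have r_ge0 : 0 <= r by rewrite divr_ge0 ?ltW.
have r_le1 : r <= 1 by rewrite ler_pdivrMr// mul1r ltW.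
set t := ssp_tan R n S xo xe q0.
have t_ge0 j : 0 <= t j by apply: (ssp_tan_ge0 R n S W xo xe (sigma 1%N)).
have t_le i j : t (i + j)%N <= r ^+ i * t j.
  by apply: (ssp_tan_le R n S W xo xe (sigma 1%N)); rewrite ?ltW.
have tE k : tan (vangle (q k.*2) xe) = t k.*2 by rewrite /t /ssp_tan /ssp_axis odd_double.
have tO k : tan (vangle (q k.*2.+1) xo) = t k.*2.+1.
  by rewrite /t /ssp_tan /ssp_axis oddS odd_double.
have t0E : tan (vangle q0 xe) = t 0%N by [].
have t1E : tan (vangle (S *m q0) xo) = t 1%N.
  by apply: (tan_vangle_mulmx_q0 R n S W xo xe (sigma 1%N)).
have rho_le k : `|rho k - sigma 1%N| <= 1 / 2 * t k.*2.+1 ^+ 2 * sigma 1%N.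
  by apply: (ssp_rho_bound R n S W xo xe (sigma 1%N) (sigma 2%N)); rewrite ?ltW.
have k2 : (Num.sqrt 2 / 2) ^+ 2 * (1 + 1) = 1 :> R.
  by rewrite expr_div_n sqr_sqrtr//; field.
split.
- by [].
- split; split.
  + exact: cvC_eigen.
  + by rewrite cnorm2_addi xo1 xe1 k2.
  + exact: cvC_eigenN.
  + rewrite /wm -scalerN -cvCN cnorm2_addi xo1 -scaleN1r.
    by rewrite dotvZl dotvZr xe1 !mulN1r opprK k2.
(* With [k] shifted by one, the odd index becomes [k.*2.+1]; the three bounds start the contraction
   at steps 0, 1 and 0. *)
- case=> [//|k] _; rewrite tE doubleS !succnK tO t0E t1E !ger0_norm//.
  split.
  + by have := t_le k.*2.+2 0%N; rewrite addn0.
  + by have := t_le k.*2 1%N; rewrite addn1.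
  + by have := t_le k.*2.+1 0%N; rewrite addn0.
(* The quadratic bound holds for every [k], so the fourth-order constant can be zero. *)
- exists 0, 0%N => k _; rewrite tO mul0r addr0; exact: rho_le.
(* The constant comes from squaring [t (2k+1) <= r ^+ (2k) * t 0] in the quadratic bound. *)
- exists (1 / 2 * t 0%N ^+ 2 * sigma 1%N), 0%N => k _.
  rewrite (le_trans (rho_le k))// [leRHS]mulrAC ler_wpM2r ?(ltW s1_gt0)//.
  rewrite -[leRHS]mulrA ler_wpM2l//.
  have := t_le k.*2.+1 0%N; rewrite addn0 => tk.
  (* One factor [r <= 1] is given up, so that squaring produces the exponent [4 * k] instead of
     [4 * k + 2]. *)
  have {}tk : t k.*2.+1 <= r ^+ k.*2 * t 0%N.
    by rewrite (le_trans tk)// ler_wpM2r// exprS ler_piMl ?exprn_ge0.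
  have -> : t 0%N ^+ 2 * r ^+ (4 * k) = (r ^+ k.*2 * t 0%N) ^+ 2.
    by rewrite [RHS]exprMn -exprM mulrC; congr (_ ^+ _ * _); lia.
  by rewrite ler_pXn2r ?nnegrE ?t_ge0// mulr_ge0 ?t_ge0 ?exprn_ge0.
Qed.
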